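(* Let $f_0=1,f_1,\dots,f_r\in\mathbb{R}[x_1,\dots,x_d]$, $r\in\mathbb{N}$. Suppose $g_1,\dots,g_m\in\mathbb{R}[x_1,\dots,x_d]$ are polynomials of degree one such that the polyhedron $\mathcal{K}(g_1,\dots,g_m):=\{x\in\mathbb{R}^d : g_1(x)\ge0,\dots,g_m(x)\ge 0\}$ is a non-empty compact set that contains the semialgebraic set $\mathcal{K}(f_1,\dots,f_r):=\{x\in\mathbb{R}^d : f_1(x)\ge 0,\dots,f_r(x)\ge 0\}$. If $p\in\mathbb{R}[x_1,\dots,x_d]$ satisfies $p(x)>0$ for all $x\in\mathcal{K}(f_1,\dots,f_r)$, then $p$ is a finite sum of polynomials of the form $$\alpha\, f_j\, g_1^{n_1}\cdots g_m^{n_m},\qquad \text{where } \alpha\in(0,+\infty),\ j\in\{0,\dots,r\},\ n_1,\dots,n_m\in\mathbb{N}_0. \qquad ( * )$$ Any linear functional on $\mathbb{R}[x_1,\dots,x_d]$ that is nonnegative on all polynomials of the form $( * )$ with $\alpha=1$ is a $\mathcal{K}(f_1,\dots,f_r)$-moment functional.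
   Context: For a closed set $\mathcal{K}\subseteq\mathbb{R}^d$, a linear functional $L$ on $\mathbb{R}[x_1,\dots,x_d]$ is a $\mathcal{K}$-moment functional if there is a Radon measure $\mu$ supported on $\mathcal{K}$ with $L(p)=\int_{\mathcal{K}}p(x)\,d\mu(x)$ for all $p\in\mathbb{R}[x_1,\dots,x_d]$. *)

(* Defs.v *)
From HB Require Import structures.
From mathcomp Require Import all_boot all_order all_algebra.
From mathcomp Require Import all_classical all_reals all_analysis.
(* The notations of mpoly clash with those of analysis. *)
From mathcomp Require Import (coercions, canonicals) mpoly.

Set Implicit Arguments.
Unset Strict Implicit.
Unset Printing Implicit Defensive.

Import Order.TTheory GRing.Theory Num.Theory.
Import numFieldNormedType.Exports.

Local Open Scope classical_set_scope.
Local Open Scope ring_scope.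

Section MomentFunctionals.
Variables (R : realType) (d : nat).

Definition mp_eval (p : mpoly.mpoly d R) (x : 'rV[R]_d) : R :=
  mpoly.meval (fun i => x ord0 i) p.

Definition semialg_set (s : nat) (h : 'I_s -> mpoly.mpoly d R) :
    set 'rV[R]_d :=
  [set x | forall i, 0 <= mp_eval (h i) x].

(* mpoly.msize is the total degree plus one. *)
Definition degree_one (p : mpoly.mpoly d R) : Prop := mpoly.msize p = 2%N.

(* 'rV[R]_d with its Borel sigma-algebra. *)
Definition borelRV := g_sigma_algebraType (@open 'rV[R]_d).

Definition radon_measure (mu : {measure set borelRV -> \bar R}) : Prop :=
  (forall C : set 'rV[R]_d, compact C -> (mu C < +oo)%E) /\
  (forall B : set borelRV, measurable B ->
     mu B = ereal_sup
       [set mu C | C in [set C : set 'rV[R]_d | compact C /\ C `<=` B]]).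

(* For closed K: mu vanishes off K iff its topological support lies in K. *)
Definition supported_on (mu : {measure set borelRV -> \bar R})
    (K : set 'rV[R]_d) : Prop :=
  mu (~` K) = 0%E.

Definition moment_functional (K : set 'rV[R]_d)
    (L : {scalar (mpoly.mpoly d R)}) : Prop :=
  exists mu : {measure set borelRV -> \bar R},
    [/\ radon_measure mu, supported_on mu K &
      forall p : mpoly.mpoly d R,
        mu.-integrable (K : set borelRV) (fun x => (mp_eval p x)%:E) /\
        (L p)%:E = (\int[mu]_(x in (K : set borelRV)) (mp_eval p x)%:E)%E].

Definition star_form (r m : nat) (f : 'I_r.+1 -> mpoly.mpoly d R)
    (g : 'I_m -> mpoly.mpoly d R)
    (alpha : R) (j : 'I_r.+1) (n : 'I_m -> nat) : mpoly.mpoly d R :=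
  alpha *: (f j * \prod_(i < m) g i ^+ n i).

End MomentFunctionals.

(* Main.v *)
Require Import Defs.
From HB Require Import structures.
From mathcomp Require Import all_boot all_order all_algebra.
From mathcomp Require Import all_classical all_reals all_analysis.
From mathcomp Require Import (coercions, canonicals) mpoly.
From mathcomp Require Import measurable_realfun ring lra.

Set Implicit Arguments.
Unset Strict Implicit.
Unset Printing Implicit Defensive.

Import Order.TTheory GRing.Theory Num.Theory.
Import numFieldNormedType.Exports.

Local Open Scope classical_set_scope.
Local Open Scope ring_scope.

(** Let S be the semiring generated by the nonnegative constants and the g_i, and
let M be the set of finite sums of polynomials of the form alpha f_j g^n.  Then
M is a convex cone stable under multiplication by S, and 1 lies in M.

S is archimedean: every polynomial a satisfies N - a in S for some constant N.
As the polyhedron is nonempty and compact, only the direction v = 0 satisfies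
n_i.v >= 0 for all the linear parts n_i of the g_i; Farkas' lemma then writes
each of the forms x_k and - x_k, up to a constant, as a nonnegative combination
of the g_i, and the polynomials bounded by constants modulo S form a subalgebra
([compact_polyhedron_archimedean]).

The first claim is an archimedean Positivstellensatz for S-modules
([archimedean_positivstellensatz]), and its heart is an extension step.  Let T
be a proper S-module cone, closed in the sense that a + eps in T for all eps > 0
implies a in T, and let rho be the least constant with rho - a in T.  Then
T + R_+ (a - rho) is again a proper S-module cone, because for s and N - s in S
    s (a - rho) = (N - s) (rho - a) + N (a - rho)
([cone_adjoin]).  So in a maximal proper S-module cone, which exists by Zorn's
lemma, every a is congruent to a constant modulo the ideal T inter - T: this is
a character, that is, evaluation at a point x, and it is nonnegative on T.  Now
let p be outside M; then M is proper, and the infimum rho of the constants r with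
r + p in M is nonnegative.  Adjoining - p - rho to the closure of M gives a proper
module, hence a point x of K(f) with p(x) <= - rho <= 0.

For the second claim, the first one shows that L is nonnegative on polynomials
that are nonnegative on the compact set K = K(f).  The same maximality argument,
with no multipliers, extends L to a positive functional Lam on all functions that
are bounded on K ([positive_extension]), so that lam(A) = Lam(1_A) is a finitely
additive content on all sets.  Regularising lam, by closed sets from inside for
open sets and then by open sets from outside, gives an outer measure for which
open sets are Caratheodory measurable, hence a Radon measure mu carried by K,
with the same total mass as lam and mu(U) <= lam(U) for U open
([content_radon_measure]).  Slicing a polynomial p >= 0 by the open sets
{p > i eps} gives that the integral of p is at most L(p); adding constants and
then replacing p by - p gives equality ([nonneg_moment_functional]). *)

(** * Cones with an order unit *)
Section ConesWithUnit.
Variables (R : realType) (V : lmodType R).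

(** The multipliers are arbitrary maps rather than elements of an algebra, so
that the same maximality argument serves for modules over a semiring and, with
no multiplier at all, for the extension of positive functionals. *)
Definition stable_cone (Phi : set (V -> V)) (T : set V) : Prop :=
  [/\ forall u v, T u -> T v -> T (u + v),
      forall c u, 0 <= c -> T u -> T (c *: u) &
      forall phi u, Phi phi -> T u -> T (phi u)].

Definition cone_closure (e : V) (T : set V) : set V :=
  [set v | forall eps, 0 < eps -> T (v + eps *: e)].

Variables (Phi : set (V -> V)) (e : V).
Hypothesis Phi_lin : forall phi, Phi phi -> linear phi.
Hypothesis Phi_compl : forall phi, Phi phi ->
  exists N : R, exists2 psi, Phi psi & forall v, phi v + psi v = N *: v.
Implicit Types (T M : set V) (a u v : V).

Lemma multiplierN phi v : Phi phi -> phi (- v) = - phi v.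
Proof.
move=> /Phi_lin Lphi.
have phi0 : phi 0 = 0.
  have := Lphi 1 0 0; rewrite !scale1r !addr0 -[X in X = _]addr0.
  by move=> /addrI.
by have := Lphi (-1) v 0; rewrite !addr0 !scaleN1r phi0 addr0.
Qed.

Lemma stable_cone_scale_unit T c d : stable_cone Phi T -> T e ->
  c <= d -> forall v, T (v + c *: e) -> T (v + d *: e).
Proof.
move=> [TD TZ _] Te cd v Tv.
have -> : v + d *: e = (v + c *: e) + (d - c) *: e.
  by rewrite -addrA -scalerDl (addrC c) subrK.
by apply: TD => //; apply: TZ => //; rewrite subr_ge0.
Qed.

Lemma sub_cone_closure T : stable_cone Phi T -> T e ->
  T `<=` cone_closure e T.
Proof. by move=> [TD TZ _] Te v Tv eps /ltW e0; apply/TD/TZ. Qed.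

Lemma cone_closure_proper T : stable_cone Phi T ->
  ~ T (- e) -> ~ cone_closure e T (- e).
Proof.
move=> [_ TZ _] NTe /(_ (2^-1)) H; apply: NTe.
have -> : - e = 2 *: (- e + 2^-1 *: e).
  by rewrite scalerDr scalerA mulfV ?pnatr_eq0// scale1r scaler_nat mulr2n subrK.
by apply: TZ => //; apply: H; rewrite invr_gt0.
Qed.

(** Stability under a multiplier phi survives the closure because the error
[phi e] is absorbed: with psi the complementary multiplier,
phi v + N h e = phi (v + h e) + h psi e. *)
Lemma cone_closure_stable T : stable_cone Phi T -> T e ->
  stable_cone Phi (cone_closure e T).
Proof.
move=> sT Te; have [TD TZ TP] := sT; split.
- move=> u v Tu Tv eps e0.
  have e2 : 0 < eps / 2 by rewrite divr_gt0.
  have -> : u + v + eps *: e = (u + (eps / 2) *: e) + (v + (eps / 2) *: e).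
    by rewrite addrACA -scalerDl -splitr.
  by apply: TD; [exact: Tu | exact: Tv].
- move=> c u c0 Tu eps e0.
  have c1 : 0 < c + 1 by rewrite ltr_wpDl.
  apply: (@stable_cone_scale_unit _ (c * (eps / (c + 1)))) => //.
    by rewrite mulrCA ger_pMr// ler_pdivrMr// mul1r lerDl.
  by rewrite -scalerA -scalerDr; apply: TZ => //; apply: Tu; rewrite divr_gt0.
- move=> phi u Pphi Tu eps e0.
  have [N [psi Ppsi phipsi]] := Phi_compl Pphi.
  have N1 : 0 < `|N| + 1 by rewrite ltr_wpDl.
  pose h := eps / (`|N| + 1).
  have h0 : 0 < h by rewrite divr_gt0.
  apply: (@stable_cone_scale_unit _ (h * N)) => //.
    rewrite /h mulrAC -mulrA ger_pMr// ler_pdivrMr// mul1r.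
    by rewrite (le_trans (ler_norm _))// lerDl.
  have -> : phi u + (h * N) *: e = phi (u + h *: e) + h *: psi e.
    rewrite addrC -[in RHS](addrC (h *: e)) Phi_lin// addrAC -scalerDr phipsi.
    by rewrite scalerA.
  by apply: TD; [apply: TP => //; exact: Tu | apply/TZ/TP => //; exact: ltW].
Qed.

(** The infimum of the bounds of [a] is attained up to the closure only, which
is why maximal cones are first shown to be closed. *)
Lemma cone_best_bound T a : stable_cone Phi T -> T e -> ~ T (- e) ->
  (exists N, T (N *: e - a)) -> (exists N, T (N *: e + a)) ->
  exists2 rho, cone_closure e T (rho *: e - a) &
    forall r, r < rho -> ~ T (r *: e - a).
Proof.
move=> sT Te NTe [N TN] [N' TN']; have [TD TZ TP] := sT.
pose E := [set r | T (r *: e - a)].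
have lbE : lbound E (- N').
  move=> r Er; rewrite leNgt; apply/negP => rN'; apply: NTe.
  have rN0 : r + N' < 0 by rewrite -ltrBrDr sub0r.
  have -> : - e = (- (r + N')^-1) *: ((r *: e - a) + (N' *: e + a)).
    rewrite addrACA addNr addr0 -scalerDl scalerA mulNr mulVf ?lt_eqF//.
    by rewrite scaleN1r.
  by apply: TZ; [rewrite oppr_ge0 invr_le0 ltW | exact: TD].
have hE : has_inf E by split; [exists N | exists (- N')].
exists (inf E).
  move=> eps e0; have [r Er rlt] := inf_adherent e0 hE.
  rewrite addrAC -scalerDl addrC.
  apply: (@stable_cone_scale_unit _ r) => //; first exact: ltW.
  by rewrite addrC.
move=> r rlt Tr; move: rlt; rewrite ltNge => /negP; apply.
by apply: ge_inf; [case: hE | exact: Tr].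
Qed.

(** Adjoining [a - rho e], with [rho] the least bound of [a], keeps the cone
stable since phi (a - rho e) = psi (rho e - a) + N (a - rho e), where phi + psi
is multiplication by N.  It keeps the cone proper since otherwise [a] would have
a bound smaller than [rho]. *)
Lemma cone_adjoin T a rho : stable_cone Phi T -> T e -> ~ T (- e) ->
  T (rho *: e - a) -> (forall r, r < rho -> ~ T (r *: e - a)) ->
  exists T', [/\ T `<=` T', stable_cone Phi T', ~ T' (- e) &
                 T' (a - rho *: e)].
Proof.
move=> [TD TZ TP] Te NTe Tra rho_min.
have T0 : T 0 by rewrite -(scale0r e); apply: TZ.
exists [set v | exists t c, [/\ T t, 0 <= c & v = t + c *: (a - rho *: e)]].
split.
- by move=> t Tt; exists t, 0; split => //; rewrite scale0r addr0.
- split.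
  + move=> _ _ [t [c [Tt c0 ->]]] [t' [c' [Tt' c'0 ->]]].
    exists (t + t'), (c + c'); split; [exact: TD | exact: addr_ge0 |].
    by rewrite scalerDl addrACA.
  + move=> k _ k0 [t [c [Tt c0 ->]]]; exists (k *: t), (k * c).
    by split; [exact: TZ | exact: mulr_ge0 | rewrite scalerDr scalerA].
  + move=> phi _ Pphi [t [c [Tt c0 ->]]].
    have [N [psi Ppsi phipsi]] := Phi_compl Pphi.
    (* The coefficient of a - rho e has to be nonnegative; N need not be. *)
    pose N' := Num.max N 0.
    have N'0 : 0 <= N' by rewrite le_max lexx orbT.
    have NN' : 0 <= N' - N by rewrite subr_ge0 le_max lexx.
    exists (phi t + c *: (psi (rho *: e - a) + (N' - N) *: (rho *: e - a))).
    exists (c * N').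
    split; last 1 first.
    * rewrite addrC (Phi_lin Pphi) addrC -addrA -scalerA -scalerDr.
      congr (_ + _ *: _).
      rewrite -[rho *: e - a]opprB (multiplierN _ Ppsi) scalerN.
      rewrite -(addrK (psi (a - rho *: e)) (phi _)) phipsi scalerBl opprB.
      by rewrite -addrA subrK addrC.
    * by apply: (TD); [exact: TP | apply: (TZ) => //; apply: TD; [exact: TP | exact: TZ]].
    * exact: mulr_ge0.
- move=> [t [c [Tt]]]; rewrite le_eqVlt => /predU1P[<-|c0].
    by rewrite scale0r addr0 => te; apply: NTe; rewrite te.
  move=> te; apply: (rho_min (rho - c^-1)).
    by rewrite ltrBlDr ltrDl invr_gt0.
  have -> : (rho - c^-1) *: e - a = c^-1 *: t.
    have -> : t = - e - c *: (a - rho *: e) by rewrite te addrK.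
    rewrite scalerDr !scalerN scalerA mulVf ?gt_eqF// scale1r scalerBl opprB.
    by rewrite [RHS]addrCA addrA.
  by apply: TZ => //; rewrite invr_ge0 ltW.
- by exists 0, 1; split => //; rewrite scale1r add0r.
Qed.

(** A maximal proper cone is closed, so it already contains [a - rho e] when
[rho] is the least bound of [a]: modulo T inter - T, bounded vectors become
multiples of [e]. *)
Lemma maximal_cone M : stable_cone Phi M -> M e -> ~ M (- e) ->
  exists T, [/\ M `<=` T, stable_cone Phi T, ~ T (- e) &
    forall a, (exists N, M (N *: e - a)) -> (exists N, M (N *: e + a)) ->
      exists r, T (a - r *: e) /\ T (r *: e - a)].
Proof.
move=> sM Me NMe.
(* The empty chain has union set0: the cone M is imposed on nonempty X only. *)
pose P X := [/\ stable_cone Phi X, ~ X (- e) & X !=set0 -> M `<=` X].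
have [F FP Ftot|T [[sT NTe MT] Tmax]] := @Zorn_bigcup V P.
  split.
  - split.
    + move=> u v [X FX Xu] [Y FY Yv].
      by have [XY|YX] := Ftot _ _ FX FY;
        [exists Y => //; have [[D _ _] _ _] := FP _ FY; apply: D => //; apply: XY
        |exists X => //; have [[D _ _] _ _] := FP _ FX; apply: D => //; apply: YX].
    + move=> c u c0 [X FX Xu]; exists X => //.
      by have [[_ Z _] _ _] := FP _ FX; exact: Z.
    + move=> phi u Pphi [X FX Xu]; exists X => //.
      by have [[_ _ Q] _ _] := FP _ FX; exact: Q.
  - by move=> [X FX Xe]; have [_ + _] := FP _ FX; apply.
  - move=> [u [X FX Xu]] v Mv; exists X => //.
    by have [_ _ MX] := FP _ FX; apply: MX => //; exists u.
have {}MT : M `<=` T.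
  have [T0|/set0P//] := eqVneq T set0.
  have TM : T `<` M by rewrite T0; split; [exact: sub0set | move=> /(_ _ Me)].
  by case: (Tmax _ TM); split => // _ x.
have Te : T e := MT _ Me.
have Tclosed v : cone_closure e T v -> T v.
  move=> Tv; apply: contrapT => nTv; apply: (Tmax (cone_closure e T)).
    by split; [exact: sub_cone_closure | move=> /(_ _ Tv)].
  split; [exact: cone_closure_stable | exact: cone_closure_proper | move=> _].
  by apply: subset_trans MT _; exact: sub_cone_closure.
exists T; split => // a [N MN] [N' MN'].
have [||rho /Tclosed Trho rho_min] := cone_best_bound sT Te NTe (a := a).
- by exists N; exact: MT.
- by exists N'; exact: MT.
exists rho; split => //.
have [T' [TT' sT' NT'e T'a]] := cone_adjoin sT Te NTe Trho rho_min.
apply: contrapT => nTa; apply: (Tmax T').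
  by split => // /(_ _ T'a).
by split => // _; exact: subset_trans TT'.
Qed.

End ConesWithUnit.

(** * Archimedean modules over a semiring *)
Section Positivstellensatz.
Variables (R : realType) (A : comAlgType R).
Implicit Types (S M : set A) (a b : A).

Definition multiplications S : set (A -> A) := [set *%R s | s in S].

(** Only upper bounds are asked for: the bounds of [- a] are lower bounds. *)
Definition archimedean S : Prop := forall a, exists N : R, S (N *: 1 - a).

Lemma multiplications_linear S phi : multiplications S phi -> linear phi.
Proof. by move=> [s _ <-] c u v; rewrite mulrDr scalerAr. Qed.

Lemma multiplications_compl S phi : archimedean S -> multiplications S phi ->
  exists N : R, exists2 psi, multiplications S psi &
    forall v, phi v + psi v = N *: v.
Proof.
move=> archS [s Ss <-]; have [N SN] := archS s.
exists N; exists ( *%R (N *: 1 - s)); first by exists (N *: 1 - s).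
by move=> v; rewrite mulrBl subrKC -scalerAl mul1r.
Qed.

(** In a maximal module T containing M the additive group T inter - T is stable
under S; since every element is a constant minus an element of S, it is an ideal,
and the quotient by it is the field of constants. *)
Lemma nonneg_character S M : archimedean S ->
  stable_cone (multiplications S) M -> M 1 -> ~ M (- 1) -> S `<=` M ->
  exists chi : {lrmorphism A -> R^o}, forall m, M m -> 0 <= chi m.
Proof.
move=> archS sM M1 NM1 SM.
have [T [MT sT NT1 Tr]] := maximal_cone (@multiplications_linear S)
  (fun phi => multiplications_compl archS) sM M1 NM1.
have [TD TZ TP] := sT.
have T1 : T 1 := MT _ M1.
have TS s a : S s -> T a -> T (s * a) by move=> Ss; apply: TP; exists s.
have Tcst c : T (c *: 1) -> 0 <= c.
  move=> Tc; rewrite leNgt; apply/negP => c0; apply: NT1.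
  have -> : - 1 = (- c^-1) *: (c *: 1) :> A.
    by rewrite scalerA mulNr mulVf ?lt_eqF// scaleN1r.
  by apply: TZ => //; rewrite oppr_ge0 invr_le0 ltW.
pose I := [set a | T a /\ T (- a)].
have ID a b : I a -> I b -> I (a + b).
  by move=> [Ta Ta'] [Tb Tb']; split; [|rewrite opprD]; exact: TD.
have IN a : I a -> I (- a) by move=> [? ?]; split; rewrite ?opprK.
have IS s a : S s -> I a -> I (s * a).
  by move=> Ss [Ta Ta']; split; [|rewrite -mulrN]; exact: TS.
have IZ c a : I a -> I (c *: a).
  move=> Ia; wlog c0 : c a Ia / 0 <= c.
    move=> H; have [|/ltW c0] := leP 0 c; first exact: H.
    by rewrite -[c]opprK scaleNr -scalerN; apply: H; rewrite ?oppr_ge0//; exact: IN.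
  by case: Ia => Ta Ta'; split; [|rewrite -scalerN]; exact: TZ.
have IM a b : I a -> I (a * b).
  move=> Ia; have [N SN] := archS b.
  have -> : a * b = N *: a - (N *: 1 - b) * a.
    by rewrite mulrBl -scalerAl mul1r subKr mulrC.
  by apply: ID; [exact: IZ | apply/IN/IS].
have Iex a : {r | I (a - r *: 1)}.
  apply/cid; have [||r [Tr1 Tr2]] := Tr a.
  - by have [N SN] := archS a; exists N; exact: SM.
  - by have [N] := archS (- a); rewrite opprK => SN; exists N; exact: SM.
  - by exists r; split => //; rewrite opprB.
pose chi a : R^o := sval (Iex a).
have chiI a : I (a - chi a *: 1) by rewrite /chi; case: (Iex a).
have chiU a r : I (a - r *: 1) -> chi a = r.
  suff le r1 r2 : I (a - r1 *: 1) -> I (a - r2 *: 1) -> r1 <= r2.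
    by move=> Ir; apply/eqP; rewrite eq_le !le.
  move=> [+ _] [_ +] => T1' T2'; rewrite -subr_ge0; apply: Tcst.
  have -> : (r2 - r1) *: 1 = (a - r1 *: 1) - (a - r2 *: 1).
    by rewrite scalerBl; ring.
  exact: TD.
have chiL : GRing.linear_for *:%R chi.
  move=> c a b; apply: chiU.
  have -> : c *: a + b - (c *: chi a + chi b) *: 1 =
            c *: (a - chi a *: 1) + (b - chi b *: 1).
    by rewrite scalerDl opprD addrACA scalerBr scalerA.
  by apply: ID => //; exact: IZ.
have chi1 : chi 1 = 1.
  apply: chiU; rewrite scale1r subrr; split; rewrite ?oppr0 -(scale0r 1);
  exact: TZ.
have chiM : {morph chi : a b / a * b}.
  move=> a b; apply: chiU.
  have -> : a * b - (chi a * chi b) *: 1 =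
            (a - chi a *: 1) * b + chi a *: (b - chi b *: 1).
    by rewrite mulrBl scalerBr addrA -scalerAl mul1r scalerA subrK.
  by apply: ID; [exact: IM | exact: IZ].
pose linchi := GRing.isLinear.Build _ _ _ _ chi chiL.
pose mulchi := GRing.isMonoidMorphism.Build _ _ chi (conj chi1 chiM).
pose chi' : {lrmorphism A -> R^o} := HB.pack chi linchi mulchi.
exists chi' => // m Mm; apply: Tcst => /=.
have [_ +] := chiI m; rewrite opprB => /(TD _ _ (MT _ Mm)).
by rewrite subrKC.
Qed.

(** If [a] were not in M, the least [rho] with [rho + a] in the closure of M would
be nonnegative; adjoining [- a - rho] would give a character with value at most
[- rho] at [a]. *)
Theorem archimedean_positivstellensatz S M a : archimedean S ->
  stable_cone (multiplications S) M -> M 1 -> S `<=` M ->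
  (forall chi : {lrmorphism A -> R^o},
     (forall m, M m -> 0 <= chi m) -> 0 < chi a) ->
  M a.
Proof.
move=> archS sM M1 SM chi_gt0; apply: contrapT => NMa.
pose mul_lin := @multiplications_linear S.
have mul_compl phi := @multiplications_compl S phi archS.
have [MD MZ MP] := sM.
have [N MN] : exists N : R, M (N *: 1 + a).
  by have [N] := archS (- a); rewrite opprK => SN; exists N; exact: SM.
have NM1 : ~ M (- 1).
  move=> M1'; apply: NMa.
  have -> : a = (a + `|N| *: 1) + `|N| *: (- 1) by rewrite scalerN addrK.
  apply: MD; last exact: MZ.
  by apply: (stable_cone_scale_unit sM M1 (ler_norm N)); rewrite addrC.
have [|| rho Trho rho_min] := cone_best_bound sM M1 NM1 (a := - a).
- by have [N' SN'] := archS (- a); exists N'; exact: SM.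
- by have [N' SN'] := archS a; exists N'; exact: SM.
have rho0 : 0 <= rho.
  rewrite leNgt; apply/negP => rho_lt0; apply: NMa.
  have := Trho (- rho); rewrite oppr_gt0 => /(_ rho_lt0).
  by rewrite addrAC -scalerDl subrr scale0r add0r opprK.
have clos_min r : r < rho -> ~ cone_closure 1 M (r *: 1 - - a).
  move=> rlt Tr; apply: (rho_min ((r + rho) / 2)); first by rewrite midf_lt.
  have := Tr ((rho - r) / 2); rewrite divr_gt0 ?subr_gt0// => /(_ isT).
  by rewrite addrAC -scalerDl; congr (M (_ *: _ + _)); field.
have [T' [TT' sT' NT'1 T'a]] := cone_adjoin mul_lin mul_compl
  (cone_closure_stable mul_lin mul_compl sM M1)
  (sub_cone_closure sM M1 M1) (cone_closure_proper sM NM1) Trho clos_min.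
have MT' : M `<=` T' by move=> m /(sub_cone_closure sM M1)/TT'.
have ST' : S `<=` T' by move=> s /SM/MT'.
have [chi chi_ge0] := nonneg_character archS sT' (MT' _ M1) NT'1 ST'.
have := chi_gt0 chi (fun m Mm => chi_ge0 m (MT' m Mm)).
have := chi_ge0 _ T'a; rewrite linearB linearN linearZ /= rmorph1.
rewrite -[_ *: _]/(rho * 1) mulr1 subr_ge0 lerNr => h1 h2.
by have := lt_le_trans h2 h1; rewrite oppr_gt0 ltNge rho0.
Qed.

End Positivstellensatz.

(** * Farkas' lemma *)
Section Farkas.
Variables (R : realFieldType) (V : lmodType R).

(** Induction on the number of forms.  If the first form a_0 cannot be dropped,
some x0 is nonnegative for the others and has b x0 < 0, hence a_0 x0 < 0.
Rescale it to y with a_0 y = -1; the projection x + a_0(x) y onto the kernel of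
a_0 reduces the claim to the remaining forms, and the coefficient that appears
in front of a_0 is nonnegative by the choice of y. *)
Lemma farkas m (a : 'I_m -> {scalar V}) (b : {scalar V}) :
  (forall x, (forall i, 0 <= a i x) -> 0 <= b x) ->
  exists2 lam : 'I_m -> R, forall i, 0 <= lam i &
    forall x, b x = \sum_i lam i * a i x.
Proof.
elim: m a b => [|m IH] a b ab.
  exists (fun=> 0) => // x; rewrite big_ord0.
  have b0 y : 0 <= b y by apply: ab; case.
  by apply/eqP; rewrite eq_le b0 andbT -oppr_ge0 -linearN b0.
have [ab'|] := pselect
    (forall x, (forall i, 0 <= a (lift ord0 i) x) -> 0 <= b x).
  have [lam lam0 blam] := IH (fun i => a (lift ord0 i)) b ab'.
  exists (fun i => if unlift ord0 i is Some j then lam j else 0).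
    by move=> i; case: unliftP => [j _|_].
  move=> x; rewrite big_ord_recl unlift_none mul0r add0r blam.
  by apply: eq_bigr => i _; rewrite liftK.
move=> /existsNP[x0 /not_implyP[ax0 /negP]]; rewrite -ltNge => bx0.
have a0x0 : a ord0 x0 < 0.
  rewrite ltNge; apply/negP => a0x0; move: bx0; rewrite ltNge => /negP; apply.
  by apply: ab => i; case: (unliftP ord0 i) => [j|] ->.
pose y := (- a ord0 x0)^-1 *: x0.
have k0 : 0 < (- a ord0 x0)^-1 by rewrite invr_gt0 oppr_gt0.
have a0y : a ord0 y = -1.
  by rewrite /y linearZ /= invrN mulNr mulVf// lt_eqF.
have by0 : b y < 0 by rewrite /y linearZ /= pmulr_rlt0.
have ay0 i : 0 <= a (lift ord0 i) y by rewrite /y linearZ /= pmulr_rge0.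
pose proj x := x + a ord0 x *: y.
have projE (f : {scalar V}) x : f (proj x) = f x + a ord0 x * f y.
  by rewrite linearD linearZ.
have proj_lin (f : {scalar V}) : scalar (f \o proj).
  by move=> c u v /=; rewrite !projE !linearP /=; ring.
pose on_ker (f : {scalar V}) : {scalar V} :=
  HB.pack (f \o proj) (GRing.isLinear.Build _ _ _ _ (f \o proj) (proj_lin f)).
have [x ax|lam lam0 blam] := IH (fun i => on_ker (a (lift ord0 i))) (on_ker b).
  apply: ab => i; case: (unliftP ord0 i) => [j|] ->; first exact: ax.
  by rewrite projE a0y mulrN1 subrr.
exists (fun i => if unlift ord0 i is Some j then lam j
          else \sum_j lam j * a (lift ord0 j) y - b y).
  move=> i; case: unliftP => [j _|_]; first exact: lam0.
  by rewrite subr_ge0 (le_trans (ltW by0))// sumr_ge0// => j _; rewrite mulr_ge0.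
move=> x; rewrite big_ord_recl unlift_none.
rewrite [X in _ = _ + X](eq_bigr (fun i => lam i * a (lift ord0 i) x)); last first.
  by move=> i _; rewrite liftK.
have blamx : b x + a ord0 x * b y =
    \sum_i lam i * a (lift ord0 i) x + a ord0 x * \sum_i lam i * a (lift ord0 i) y.
  rewrite -projE -[LHS]/(on_ker b x) blam mulr_sumr -big_split; apply: eq_bigr => i _.
  by rewrite -[on_ker _ x]/(a (lift ord0 i) (proj x)) projE mulrDr mulrCA.
by rewrite -[LHS](addrK (a ord0 x * b y)) blamx; ring.
Qed.

End Farkas.

(** * Polynomials: induction, evaluation, degree one *)
Section PolynomialAlgebra.
Variables (R : realType) (d : nat).
Local Notation mp := (mpoly.mpoly d R).
Local Notation "'X_ i" := (mpoly.mpolyX R (mpoly.mnm1 i) : mp)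
  (at level 8, i at level 2).

Lemma mpoly_gen_ind (P : mp -> Prop) : P 1 -> (forall i, P 'X_i) ->
  (forall p q, P p -> P q -> P (p + q)) ->
  (forall p q, P p -> P q -> P (p * q)) ->
  (forall c p, P p -> P (c *: p)) -> forall p, P p.
Proof.
move=> P1 PX PD PM PZ p.
have P0 : P 0 by rewrite -(scale0r 1); exact: PZ.
have PE q k : P q -> P (q ^+ k).
  by move=> Pq; elim: k => [|k IH]; rewrite ?expr0// exprS; exact: PM.
rewrite [p]mpoly.mpolyE; elim/big_ind: _ => // m _; apply: PZ.
by rewrite mpoly.mpolyXE_id; elim/big_ind: _ => // i _; exact: PE.
Qed.

Lemma mp_evalD (p q : mp) x : mp_eval (p + q) x = mp_eval p x + mp_eval q x.
Proof. exact: rmorphD. Qed.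
Lemma mp_evalM (p q : mp) x : mp_eval (p * q) x = mp_eval p x * mp_eval q x.
Proof. exact: rmorphM. Qed.
Lemma mp_eval1 x : mp_eval (1 : mp) x = 1.
Proof. exact: rmorph1. Qed.
Lemma mp_evalZ c (p : mp) x : mp_eval (c *: p) x = c * mp_eval p x.
Proof. exact: mpoly.mevalZ. Qed.
Lemma mp_evalX i x : mp_eval 'X_i x = x ord0 i.
Proof. exact: mpoly.mevalXU. Qed.

Lemma mp_eval_continuous (p : mp) : continuous (mp_eval p).
Proof.
elim/mpoly_gen_ind: p => [|i|p q cp cq|p q cp cq|c p cp] x.
- rewrite (_ : mp_eval 1 = cst 1); first exact: cst_continuous.
  by apply/funext => y; exact: mp_eval1.
- rewrite (_ : mp_eval _ = fun y : 'rV_d => y ord0 i); first exact: coord_continuous.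
  by apply/funext => y; exact: mp_evalX.
- rewrite (_ : mp_eval _ = (fun y => mp_eval p y + mp_eval q y)).
    by apply: continuousD; [exact: (cp x) | exact: (cq x)].
  by apply/funext => y; exact: mp_evalD.
- rewrite (_ : mp_eval _ = (fun y => mp_eval p y * mp_eval q y)).
    by apply: continuousM; [exact: (cp x) | exact: (cq x)].
  by apply/funext => y; exact: mp_evalM.
- rewrite (_ : mp_eval _ = (fun y => c * mp_eval p y)).
    by apply: continuousM; [exact: cst_continuous | exact: (cp x)].
  by apply/funext => y; exact: mp_evalZ.
Qed.

Lemma character_eval (chi : {lrmorphism mp -> R^o}) :
  exists x, forall p, chi p = mp_eval p x.
Proof.
exists (\row_k chi 'X_k) => p.
elim/mpoly_gen_ind: p => [|i|p q cp cq|p q cp cq|c p cp].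
- by rewrite rmorph1 mp_eval1.
- by rewrite mp_evalX mxE.
- by rewrite mp_evalD -cp -cq; exact: linearD.
- by rewrite mp_evalM -cp -cq; exact: rmorphM.
- by rewrite mp_evalZ -cp; exact: linearZ.
Qed.

Lemma degree_oneE (p : mp) : degree_one p ->
  p = mpoly.mcoeff mpoly.mnm0 p *: 1 + \sum_k mpoly.mcoeff (mpoly.mnm1 k) p *: 'X_k.
Proof.
move=> p1; apply/mpoly.mpolyP => m.
rewrite mpoly.mcoeffD mpoly.mcoeffZ mpoly.mcoeff1.
rewrite (raddf_sum (mpoly.mcoeff m)) /=.
under eq_bigr do rewrite mpoly.mcoeffZ mpoly.mcoeffX.
have [m0|m_neq0] := eqVneq m mpoly.mnm0.
  rewrite m0 mulr1 big1 ?addr0// => k _.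
  by rewrite mpoly.mnm1_eq0 mulr0.
rewrite mulr0 add0r.
have [/eqP/mpoly.mdeg1P[k /eqP mk]|m_neq1] := eqVneq (mpoly.mdeg m) 1%N.
  rewrite (bigD1 k)//= mk eqxx mulr1 big1 ?addr0// => j jk.
  by rewrite mpoly.eq_mnm1 (negbTE jk) mulr0.
rewrite mpoly.memN_msupp_eq0; last first.
  apply: mpoly.msize_mdeg_ge; rewrite p1 ltn_neqAle eq_sym m_neq1 lt0n.
  by rewrite mpoly.mdeg_eq0.
rewrite big1// => k _; case: eqP => [mk|_]; last by rewrite mulr0.
by move: m_neq1; rewrite -mk mpoly.mdeg1.
Qed.

End PolynomialAlgebra.

(** * The semiring generated by a set *)
Section GeneratedSemiring.
Variables (R : realType) (A : comAlgType R) (G : set A).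

Inductive generated_semiring : set A :=
| gen_cst c : 0 <= c -> generated_semiring (c *: 1)
| gen_in a : G a -> generated_semiring a
| gen_add a b : generated_semiring a -> generated_semiring b ->
    generated_semiring (a + b)
| gen_mul a b : generated_semiring a -> generated_semiring b ->
    generated_semiring (a * b).

Definition gen_bounded (a : A) : Prop :=
  exists N : R, generated_semiring (N *: 1 - a) /\
                generated_semiring (N *: 1 + a).

Lemma gen_bounded1 : gen_bounded 1.
Proof.
exists 1; rewrite scale1r subrr -(scale0r 1); split; first exact: gen_cst.
by rewrite -[1]scale1r -scalerDl; apply: gen_cst; rewrite addr_ge0.
Qed.

Lemma gen_boundedD a b : gen_bounded a -> gen_bounded b -> gen_bounded (a + b).
Proof.
move=> [N [Na Na']] [K [Kb Kb']]; exists (N + K); rewrite scalerDl; split.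
  by rewrite opprD addrACA; exact: gen_add.
by rewrite addrACA; exact: gen_add.
Qed.

Lemma gen_scale c a : 0 <= c -> generated_semiring a ->
  generated_semiring (c *: a).
Proof.
by move=> c0 ga; rewrite -[a]mul1r scalerAl; apply: gen_mul => //; exact: gen_cst.
Qed.

Lemma gen_boundedZ c a : gen_bounded a -> gen_bounded (c *: a).
Proof.
move=> [N [Na Na']]; have [c0|/ltW c0] := leP 0 c.
  by exists (c * N); rewrite -scalerA -scalerBr -scalerDr; split; exact: gen_scale.
exists (- c * N); rewrite -scalerA; split.
  by rewrite -[- (c *: a)]scaleNr -scalerDr; apply: gen_scale; rewrite ?oppr_ge0.
by rewrite -[c *: a]opprK -scaleNr -scalerBr; apply: gen_scale; rewrite ?oppr_ge0.
Qed.

(** 2 (N K - a b) = (N - a) (K + b) + (N + a) (K - b), and similarly for the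
lower bound. *)
Lemma gen_boundedM a b : gen_bounded a -> gen_bounded b -> gen_bounded (a * b).
Proof.
move=> [N [Na Na']] [K [Kb Kb']]; exists (N * K).
have half : 0 <= 2^-1 :> R by rewrite invr_ge0.
have NK : (N * K) *: 1 = (N *: 1) * (K *: 1) :> A.
  by rewrite -scalerAl mul1r scalerA.
have dbl (x : A) : 2^-1 *: (x + x) = x.
  by rewrite scalerDr -scalerDl -[RHS]scale1r; congr (_ *: _); field.
split.
  rewrite -[_ - _]dbl.
  have -> : (N * K) *: 1 - a * b + ((N * K) *: 1 - a * b) =
    (N *: 1 - a) * (K *: 1 + b) + (N *: 1 + a) * (K *: 1 - b).
    by rewrite NK; ring.
  by apply: gen_scale => //; apply: gen_add; exact: gen_mul.
rewrite -[_ + _]dbl.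
have -> : (N * K) *: 1 + a * b + ((N * K) *: 1 + a * b) =
  (N *: 1 - a) * (K *: 1 - b) + (N *: 1 + a) * (K *: 1 + b).
  by rewrite NK; ring.
by apply: gen_scale => //; apply: gen_add; exact: gen_mul.
Qed.

End GeneratedSemiring.

(** * Compact polyhedra yield archimedean semirings *)
Section CompactPolyhedron.
Variables (R : realType) (d : nat).
Local Notation mp := (mpoly.mpoly d R).
Local Notation "'X_ i" := (mpoly.mpolyX R (mpoly.mnm1 i) : mp)
  (at level 8, i at level 2).

Lemma compact_mp_eval_bounded (K : set 'rV[R]_d) (p : mp) : compact K ->
  exists M, forall x, K x -> `|mp_eval p x| <= M.
Proof.
move=> cK; have : compact (mp_eval p @` K).
  by apply: continuous_compact => //; apply/continuous_subspaceT/mp_eval_continuous.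
move=> /(@compact_bounded _ R^o) [M [_ HM]]; exists (M + 1) => x Kx.
by apply: (HM (M + 1)); [rewrite ltrDl | exists x].
Qed.

Lemma degree_one_eval (p : mp) x : degree_one p -> mp_eval p x =
  mpoly.mcoeff mpoly.mnm0 p + \sum_k mpoly.mcoeff (mpoly.mnm1 k) p * x ord0 k.
Proof.
move=> /degree_oneE {1}->; rewrite mp_evalD mp_evalZ mp_eval1 mulr1.
congr (_ + _); rewrite /mp_eval raddf_sum; apply: eq_bigr => k _.
by rewrite -[LHS]/(mp_eval (_ *: _) x) mp_evalZ mp_evalX.
Qed.

Definition linear_part (p : mp) (v : 'rV[R]_d) : R :=
  \sum_k mpoly.mcoeff (mpoly.mnm1 k) p * v ord0 k.

Lemma linear_part_scalar p : scalar (linear_part p).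
Proof.
move=> c u v; rewrite /linear_part mulr_sumr -big_split; apply: eq_bigr => k _.
by rewrite !mxE mulrDr mulrCA.
Qed.

HB.instance Definition _ p := GRing.isLinear.Build _ _ _ _ (linear_part p)
  (linear_part_scalar p).

Lemma linear_part_delta p k :
  linear_part p (delta_mx ord0 k) = mpoly.mcoeff (mpoly.mnm1 k) p.
Proof.
rewrite /linear_part (bigD1 k)//= mxE !eqxx mulr1 big1 ?addr0// => j jk.
by rewrite mxE (negbTE jk) andbF mulr0.
Qed.

Variables (m : nat) (g : 'I_m -> mp).
Hypothesis g_deg1 : forall i, degree_one (g i).
Hypothesis g_neq0 : semialg_set g !=set0.
Hypothesis g_compact : compact (semialg_set g).

(** Otherwise a half-line with direction [v] would stay in the polyhedron and
some coordinate would be unbounded on it. *)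
Lemma compact_recession v : (forall i, 0 <= linear_part (g i) v) -> v = 0.
Proof.
move=> v0; have [x0 Kx0] := g_neq0.
apply/rowP => k; rewrite mxE.
have [M HM] := compact_mp_eval_bounded 'X_k g_compact.
have vM (t : R) : 0 <= t -> `|x0 ord0 k + t * v ord0 k| <= M.
  move=> t0; have := HM (x0 + t *: v); rewrite mp_evalX !mxE; apply => i.
  rewrite degree_one_eval// -[X in _ + X]/(linear_part (g i) (x0 + t *: v)).
  rewrite linearD linearZ /= addrA addr_ge0 ?mulr_ge0//.
  by have := Kx0 i; rewrite degree_one_eval.
apply/eqP; apply: contraT => vk0.
have vk1 : 0 < `|v ord0 k| by rewrite normr_gt0.
pose t := (M + `|x0 ord0 k| + 1) / `|v ord0 k|.
have M0 : 0 <= M by rewrite (le_trans _ (vM 0 _)).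
have t0 : 0 <= t by rewrite divr_ge0// addr_ge0// addr_ge0.
have := vM t t0; rewrite leNgt => /negP[].
have : `|t * v ord0 k| <= `|x0 ord0 k + t * v ord0 k| + `|x0 ord0 k|.
  by rewrite -{1}(addKr (x0 ord0 k) (t * _)) addrC (le_trans (ler_normB _ _)).
rewrite normrM (ger0_norm t0) /t divfK ?gt_eqF//; lra.
Qed.

(** Bounded elements form a subalgebra, so it is enough to bound the variables:
Farkas' lemma applies to c x_k because its hypothesis only concerns v = 0, by
[compact_recession]. *)
Lemma compact_polyhedron_archimedean :
  archimedean (generated_semiring (range g)).
Proof.
suff bnd p : gen_bounded (range g) p by move=> p; have [N []] := bnd p; exists N.
elim/mpoly_gen_ind: p => [|k|p q Dp Dq|p q Dp Dq|c p Dp].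
- exact: gen_bounded1.
- have shift (N N' : R) p : N <= N' -> generated_semiring (range g) (N *: 1 + p) ->
      generated_semiring (range g) (N' *: 1 + p).
    move=> NN' gN; have -> : N' *: 1 + p = (N' - N) *: 1 + (N *: 1 + p).
      by rewrite addrA -scalerDl subrK.
    by apply: gen_add => //; apply: gen_cst; rewrite subr_ge0.
  have half (c : R) : exists N, generated_semiring (range g) (N *: 1 + c *: 'X_k).
    have [|lam lam0 lamE] := @farkas _ _ _ (fun i => linear_part (g i))
      (linear_part (c *: 'X_k)).
      by move=> v /compact_recession ->; rewrite linear0.
    have lamX j : mpoly.mcoeff (mpoly.mnm1 j) (c *: 'X_k) =
        \sum_i lam i * mpoly.mcoeff (mpoly.mnm1 j) (g i).
      rewrite -linear_part_delta [LHS]lamE; apply: eq_bigr => i _.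
      by congr (_ * _); exact: linear_part_delta.
    exists (\sum_i lam i * mpoly.mcoeff mpoly.mnm0 (g i)).
    have -> : (\sum_i lam i * mpoly.mcoeff mpoly.mnm0 (g i)) *: 1 + c *: 'X_k =
        \sum_i lam i *: g i.
      under [RHS]eq_bigr do rewrite [g _]degree_oneE// scalerDr scalerA.
      rewrite big_split /= -scaler_suml; congr (_ + _).
      under [RHS]eq_bigr do rewrite scaler_sumr.
      rewrite exchange_big /= (bigD1 k)//= [X in _ = _ + X]big1 ?addr0.
        under [RHS]eq_bigr do rewrite scalerA.
        rewrite -scaler_suml; congr (_ *: _).
        by rewrite -lamX mpoly.mcoeffZ mpoly.mcoeffXU eqxx mulr1.
      move=> j jk; under eq_bigr do rewrite scalerA.
      rewrite -scaler_suml -lamX mpoly.mcoeffZ mpoly.mcoeffXU eq_sym (negbTE jk).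
      by rewrite mulr0 scale0r.
    elim/big_ind: _ => [|a b|i _]; [|exact: gen_add|].
      by rewrite -(scale0r 1); exact: gen_cst.
    by apply: gen_scale => //; apply: gen_in; exists i.
  have [N1] := half (-1); have [N2] := half 1.
  rewrite scaleN1r scale1r => gN2 gN1; exists (Num.max N1 N2).
  by split; [apply: shift gN1 | apply: shift gN2]; rewrite le_max lexx ?orbT.
- exact: gen_boundedD.
- exact: gen_boundedM.
- exact: gen_boundedZ.
Qed.

End CompactPolyhedron.

(** * Sums of polynomials of the required form *)
Section StarForms.
Variables (R : realType) (d r m : nat).
Local Notation mp := (mpoly.mpoly d R).
Variables (f : 'I_r.+1 -> mp) (g : 'I_m -> mp).
Hypothesis f0 : f ord0 = 1.

Definition star_sums : set mp := [set p | exists s : seq mp,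
  (forall q, q \in s ->
     exists (alpha : R) j n, 0 < alpha /\ q = star_form f g alpha j n) /\
  p = \sum_(q <- s) q].

Lemma star_sums_form alpha j n : 0 < alpha -> star_sums (star_form f g alpha j n).
Proof.
move=> a0; exists [:: star_form f g alpha j n]; rewrite big_seq1; split => // q.
by rewrite inE => /eqP ->; exists alpha, j, n.
Qed.

Lemma star_sums0 : star_sums 0.
Proof. by exists [::]; rewrite big_nil; split. Qed.

Lemma star_sumsD p q : star_sums p -> star_sums q -> star_sums (p + q).
Proof.
move=> [s [sP ->]] [t [tP ->]]; exists (s ++ t); rewrite big_cat; split => // u.
by rewrite mem_cat => /orP[/sP|/tP].
Qed.

Lemma star_sums_ind (P : mp -> Prop) : P 0 ->
  (forall p q, P p -> P q -> P (p + q)) ->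
  (forall alpha j n, 0 < alpha -> P (star_form f g alpha j n)) ->
  forall p, star_sums p -> P p.
Proof.
move=> P0 PD Pstar _ [s [sP ->]]; rewrite big_seq.
elim/big_ind: _ => // q /sP [alpha [j [n [a0 ->]]]]; exact: Pstar.
Qed.

Lemma star_sumsZ c p : 0 <= c -> star_sums p -> star_sums (c *: p).
Proof.
rewrite le_eqVlt => /predU1P[<- _|c0]; first by rewrite scale0r; exact: star_sums0.
elim/star_sums_ind => [|u v|alpha j n a0]; first by rewrite scaler0; exact: star_sums0.
  by rewrite scalerDr; exact: star_sumsD.
by rewrite /star_form scalerA; apply: star_sums_form; rewrite mulr_gt0.
Qed.

Lemma star_sumsM a p : generated_semiring (range g) a -> star_sums p ->
  star_sums (a * p).
Proof.
move=> ga; elim: ga p => {a} [c c0|_ [i _ <-]|a b _ IHa _ IHb|a b _ IHa _ IHb] p Mp.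
- by rewrite -scalerAl mul1r; exact: star_sumsZ.
- elim/star_sums_ind: Mp => [|u v|alpha j n a0].
    by rewrite mulr0; exact: star_sums0.
    by rewrite mulrDr; exact: star_sumsD.
  have -> : g i * star_form f g alpha j n =
      star_form f g alpha j (fun k => (k == i) + n k)%N.
    rewrite /star_form -scalerAr; congr (_ *: _); rewrite mulrCA; congr (_ * _).
    rewrite (bigD1 i)//= [RHS](bigD1 i)//= eqxx exprS mulrA; congr (_ * _).
    by apply: eq_bigr => k /negbTE ->; rewrite add0n.
  exact: star_sums_form.
- by rewrite mulrDl; apply: star_sumsD; [exact: IHa | exact: IHb].
- by rewrite -mulrA; apply/IHa/IHb.
Qed.

Lemma star_form_f j : star_form f g 1 j (fun=> 0%N) = f j.
Proof. by rewrite /star_form scale1r big1 ?mulr1// => i _; rewrite expr0. Qed.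

Lemma star_sums_f j : star_sums (f j).
Proof. by rewrite -star_form_f; exact: star_sums_form. Qed.

Lemma star_sums_stable :
  stable_cone (multiplications (generated_semiring (range g))) star_sums.
Proof.
split; [exact: star_sumsD | by move=> c p; exact: star_sumsZ |].
by move=> phi p [a ga <-]; exact: star_sumsM.
Qed.

(** Characters of the polynomial algebra are evaluations, and a point at which
all the f_j are nonnegative is a point of K(f). *)
Theorem star_sums_positivstellensatz p :
  archimedean (generated_semiring (range g)) ->
  (forall x, semialg_set (fun j : 'I_r => f (lift ord0 j)) x ->
     0 < mp_eval p x) ->
  star_sums p.
Proof.
move=> archg p_gt0.
have M1 : star_sums 1 by rewrite -f0; exact: star_sums_f.
apply: (archimedean_positivstellensatz archg star_sums_stable M1).
  by move=> a ga; rewrite -[a]mulr1; exact: star_sumsM.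
move=> chi chi_ge0; have [x chiE] := character_eval chi; rewrite chiE.
by apply: p_gt0 => j; rewrite -chiE; apply: chi_ge0; exact: star_sums_f.
Qed.

End StarForms.

(** * From a finitely additive content to a Radon measure *)
Section RieszMeasure.
Variables (R : realType) (d : nat).
Local Notation T := 'rV[R]_d.
Local Notation borelT := (borelRV R d).

Variables (K : set T) (lam : set T -> R).
Hypothesis K_compact : compact K.
Hypothesis K_closed : closed K.
Hypothesis lam_ge0 : forall A, 0 <= lam A.
Hypothesis lamU : forall A B, A `&` B = set0 -> lam (A `|` B) = lam A + lam B.
Hypothesis lamK : lam (~` K) = 0.

Lemma content0 : lam set0 = 0.
Proof.
have := lamU (setI0 set0); rewrite setU0 => /eqP.
by rewrite -[X in X == _]addr0 => /eqP/addrI.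
Qed.

Lemma le_content A B : A `<=` B -> lam A <= lam B.
Proof.
move=> AB; have <- : A `|` (B `\` A) = B by rewrite setDUK.
by rewrite lamU ?lerDl// setDIK.
Qed.

Lemma contentU_le A B : lam (A `|` B) <= lam A + lam B.
Proof.
have -> : A `|` B = A `|` (B `\` A).
  by rewrite setUDr setDv setD0.
by rewrite lamU ?setDIK// lerD2l; apply: le_content; exact: subDsetl.
Qed.

Lemma content_bigsetU_le (F : nat -> set T) n :
  lam (\big[setU/set0]_(i < n) F i) <= \sum_(i < n) lam (F i).
Proof.
elim: n => [|n IH]; first by rewrite !big_ord0 content0.
by rewrite !big_ord_recr /= (le_trans (contentU_le _ _))// lerD2r.
Qed.

Lemma contentIK A : lam A = lam (A `&` K).
Proof.
apply/eqP; rewrite eq_le [X in _ && X]le_content ?andbT; last exact: subIsetl.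
rewrite -[in leLHS](setUIDK A K) (le_trans (contentU_le _ _))// gerDl -lamK.
by rewrite setDE; apply: le_content; exact: subIsetr.
Qed.

(** Closed sets are used instead of compact ones: the content vanishes off the
compact set K, so both give the same value. *)
Definition inner_content (A : set T) : \bar R :=
  ereal_sup [set (lam C)%:E | C in [set C | closed C /\ C `<=` A]].

Definition outer_content (A : set T) : \bar R :=
  ereal_inf [set inner_content U | U in [set U | open U /\ A `<=` U]].

Lemma inner_content_ge C A : closed C -> C `<=` A ->
  ((lam C)%:E <= inner_content A)%E.
Proof. by move=> cC CA; apply: ereal_sup_ubound; exists C. Qed.

Lemma inner_content_le A : (inner_content A <= (lam A)%:E)%E.
Proof.
by apply: ge_ereal_sup => _ [C [_ CA] <-]; rewrite lee_fin le_content.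
Qed.

Lemma inner_content_ge0 A : (0 <= inner_content A)%E.
Proof.
by apply: le_trans (inner_content_ge closed0 (@sub0set _ A)); rewrite lee_fin.
Qed.

Lemma le_inner_content A B : A `<=` B ->
  (inner_content A <= inner_content B)%E.
Proof.
move=> AB; apply: ge_ereal_sup => _ [C [cC CA] <-].
by apply: inner_content_ge => //; exact: subset_trans AB.
Qed.

(** Shrinking an open set by [e] leaves room for a closed set inside it, which
replaces a partition of unity in the next proof. *)
Lemma closure_erosion (U : set T) (e : R) : 0 < e ->
  closure [set x | ball x e `<=` U] `<=` U.
Proof.
move=> e0 x /(_ (ball x e)) [|y [+ xy]]; first exact: nbhsx_ballx.
by apply; exact: ball_sym.
Qed.

(** By compactness, the trace on K of a closed subset of the union is covered by
the 1/(n+1)-erosions of finitely many [U i]; the closures of these erosions split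
the closed set into pieces lying in the [U i]. *)
Lemma inner_content_sigma_subadditive (U : nat -> set T) :
  (forall i, open (U i)) ->
  (inner_content (\bigcup_i U i) <= \sum_(i <oo) inner_content (U i))%E.
Proof.
move=> oU; apply: ge_ereal_sup => _ [C [cC CU] <-].
pose E n i := [set x | ball x n.+1%:R^-1 `<=` U i].
have [n Kn] : exists n, C `&` K `<=` [set x | exists2 i, (i < n)%N & E n i x].
  have cCK : compact (C `&` K) by rewrite setIC; exact: compact_closedI.
  have /compact_near_coveringP := cCK.
  move=> /(_ nat \oo (fun n x => exists2 i, (i < n)%N & E n i x) _).
  case.
    move=> x [Cx Kx]; have [i _ Uix] := CU _ Cx.
    have /nbhs_ballP[e e0 xeU] : nbhs x (U i).
      by apply: open_nbhs_nbhs; split => //; exact: oU.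
    have e2 : 0 < e / 2 by rewrite divr_gt0.
    exists (ball x (e / 2), [set n | (i < n)%N /\ n.+1%:R^-1 <= e / 2]).
      split => /=; first exact: nbhsx_ballx.
      apply: filterI; first exact: nbhs_infty_gt.
      have := near_infty_natSinv_lt (PosNum e2).
      by apply: filterS => n /ltW.
    move=> [x' n] /= [xx' [ni ne]]; exists i => //.
    move=> y x'y; apply: xeU; rewrite /= (splitr e).
    by apply: (ball_triangle xx'); exact: le_ball x'y.
  by move=> n _ /(_ n (leqnn n)) Kn; exists n.
rewrite contentIK; pose F i := C `&` closure (E n i).
apply: (@le_trans _ _ (lam (\big[setU/set0]_(i < n) F i))%:E).
  rewrite lee_fin; apply: le_content => x [Cx Kx].
  have [i ni Eix] := Kn _ (conj Cx Kx).
  rewrite -bigcup_mkord; exists i => //; split => //; exact: subset_closure.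
apply: (@le_trans _ _ (\sum_(i < n) (lam (F i))%:E)).
  by rewrite sumEFin lee_fin; exact: content_bigsetU_le.
apply: (@le_trans _ _ (\sum_(0 <= i < n) inner_content (U i))%E).
  rewrite big_mkord; apply: lee_sum => i _; apply: inner_content_ge.
    by apply: closedI => //; exact: closed_closure.
  by move=> x [_ /closure_erosion]; apply; rewrite invr_gt0.
apply: nneseries_lim_ge => i _ _; exact: inner_content_ge0.
Qed.

Lemma outer_content_open U : open U -> outer_content U = inner_content U.
Proof.
move=> oU; apply/eqP; rewrite eq_le; apply/andP; split.
  by apply: ereal_inf_lbound; exists U => //; split.
by apply: le_ereal_inf_tmp => _ [V [_ UV] <-]; exact: le_inner_content.
Qed.

Lemma outer_content_le_inner A U : open U -> A `<=` U ->
  (outer_content A <= inner_content U)%E.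
Proof. by move=> oU AU; apply: ereal_inf_lbound; exists U. Qed.

Lemma outer_content_ge0 A : (0 <= outer_content A)%E.
Proof.
by apply: le_ereal_inf_tmp => _ [U _ <-]; exact: inner_content_ge0.
Qed.

Lemma le_outer_content A B : A `<=` B -> (outer_content A <= outer_content B)%E.
Proof.
move=> AB; apply: le_ereal_inf_tmp => _ [U [oU BU] <-].
by apply: outer_content_le_inner => //; exact: subset_trans BU.
Qed.

Lemma outer_content_fin A : outer_content A \is a fin_num.
Proof.
rewrite ge0_fin_numE ?outer_content_ge0//.
apply: le_lt_trans (outer_content_le_inner openT (@subsetT _ A)) _.
by apply: le_lt_trans (inner_content_le _) _; exact: ltry.
Qed.

Lemma outer_content_approx A (e : R) : 0 < e ->
  exists U, [/\ open U, A `<=` U &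
    (inner_content U <= outer_content A + e%:E)%E].
Proof.
move=> e0; have [_ [U [oU AU] <-] /ltW ?] :=
  lb_ereal_inf_adherent e0 (outer_content_fin A).
by exists U.
Qed.

Lemma outer_content0 : outer_content set0 = 0%E.
Proof.
rewrite outer_content_open; last exact: open0.
apply/eqP; rewrite eq_le inner_content_ge0 andbT.
by rewrite (le_trans (inner_content_le _))// content0.
Qed.

Lemma outer_content_sigma_subadditive : sigma_subadditive outer_content.
Proof.
move=> A; apply/lee_addgt0Pr => e e0.
rewrite (le_trans _ (epsilon_trick _ _ (ltW e0)))//; last first.
  by move=> n; exact: outer_content_ge0.
have /choice[U AU] n : exists U, [/\ open U, A n `<=` U &
    (inner_content U <= outer_content (A n) + (e / (2 ^ n.+1)%:R)%:E)%E].
  by apply: outer_content_approx; rewrite divr_gt0// ltr0n expn_gt0.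
apply: (@le_trans _ _ (inner_content (\bigcup_n U n))).
  apply: outer_content_le_inner.
    by apply: bigcup_open => n _; have [] := AU n.
  by move=> x [n _ Anx]; exists n => //; have [_ + _] := AU n; apply.
apply: le_trans (inner_content_sigma_subadditive _) _.
  by move=> n; have [] := AU n.
apply: lee_nneseries => n _; first by move=> _; exact: inner_content_ge0.
by have [] := AU n.
Qed.

(** In an open neighbourhood U of X, a closed C almost exhausting the content of
U inter O leaves the open set U minus C around X minus O. *)
Lemma open_caratheodory_content O : open O ->
  forall X, (outer_content (X `&` O) + outer_content (X `&` ~` O)
    <= outer_content X)%E.
Proof.
move=> oO X; apply: le_ereal_inf_tmp => _ [U [oU XU] <-].
apply: (@le_trans _ _ (inner_content (U `&` O) + outer_content (X `&` ~` O))%E).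
  by rewrite leeD2r// outer_content_le_inner//; [exact: openI | exact: setSI].
rewrite -leeBrDr ?outer_content_fin//.
apply: ge_ereal_sup => _ [C [cC CUO] <-].
rewrite leeBrDr ?outer_content_fin// -leeBrDl//.
apply: (@le_trans _ _ (inner_content (U `\` C))).
  apply: outer_content_le_inner; first by
    rewrite setDE; apply: openI => //; rewrite openC.
  by move=> x [Xx Ox]; split; [exact: XU | move=> /CUO[]].
apply: ge_ereal_sup => _ [D [cD DUC] <-].
rewrite leeBrDl// -EFinD -lamU; last first.
  by apply/seteqP; split => // x [Cx /DUC[]].
apply: inner_content_ge; first exact: closedU.
by move=> x [/CUO[]|/DUC[]].
Qed.

Lemma outer_content_measure :
  exists mu : {measure set borelT -> \bar R}, forall A, mu A = outer_content A.
Proof.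
pose mu : {outer_measure set T -> \bar R} := HB.pack outer_content
  (isOuterMeasure.Build R T outer_content outer_content0 outer_content_ge0
    le_outer_content outer_content_sigma_subadditive).
pose mu' : {measure set (caratheodory_type mu) -> \bar R} := mu.
have borel_cara (A : set borelT) : measurable A ->
    measurable (A : set (caratheodory_type mu)).
  move: A; apply: smallest_sub; first exact: sigma_algebra_measurable.
  move=> A oA; apply: (@le_caratheodory_measurable _ _ mu).
  exact: open_caratheodory_content.
have sigma_add : semi_sigma_additive (outer_content : set borelT -> \bar R).
  move=> F mF tF mUF; apply: (@measure_semi_sigma_additive _ _ _ mu') => //.
    by move=> n; exact: borel_cara.
  exact: borel_cara.
pose nu : {measure set borelT -> \bar R} := HB.pack
  (outer_content : set borelT -> \bar R) (isMeasure.Build _ _ _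
    (outer_content : set borelT -> \bar R) outer_content0
    outer_content_ge0 sigma_add).
by exists nu.
Qed.

(** Inner regularity for an arbitrary Borel set is outer regularity of its
complement, intersected with K. *)
Theorem content_radon_measure :
  exists mu : {measure set borelT -> \bar R},
  [/\ mu setT = (lam setT)%:E, mu (~` K) = 0%E,
      forall U : set T, open U -> (mu U <= (lam U)%:E)%E,
      forall A, (mu A < +oo)%E &
      forall B : set borelT, measurable B -> mu B = ereal_sup
        [set mu C | C in [set C : set T | compact C /\ C `<=` B]]].
Proof.
have [mu muE] := outer_content_measure; exists mu.
have mu_open U : open U -> mu U = inner_content U.
  by move=> oU; rewrite muE outer_content_open.
have open_measurable (U : set T) : open U -> measurable (U : set borelT).
  exact: sub_sigma_algebra.
(* Monotonicity on all sets, measurable or not: mu is an outer measure. *)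
have mu_le A B : A `<=` B -> (mu A <= mu B)%E.
  by rewrite !muE; exact: le_outer_content.
have muT : mu setT = (lam setT)%:E.
  rewrite mu_open; last exact: openT.
  apply/eqP; rewrite eq_le inner_content_le/=.
  by apply: inner_content_ge => //; exact: closedT.
have mu_fin A : mu A \is a fin_num by rewrite muE outer_content_fin.
have muK : mu (~` K) = 0%E.
  apply/eqP; rewrite eq_le measure_ge0 andbT mu_open ?openC//.
  by rewrite (le_trans (inner_content_le _))// lamK.
split => //.
- by move=> U oU; rewrite mu_open// inner_content_le.
- by move=> A; rewrite ltey_eq mu_fin.
move=> B mB; apply/eqP; rewrite eq_le; apply/andP; split; last first.
  by apply: ge_ereal_sup => _ [C [_ CB] <-]; exact: mu_le.
apply/lee_addgt0Pr => e e0.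
have [U [oU BU Ue]] := outer_content_approx (~` B) e0.
have mU := open_measurable _ oU.
have mnK : measurable (~` K : set borelT).
  by apply: open_measurable; rewrite openC.
have mC : measurable (~` U `&` K : set borelT).
  apply: measurableI; first exact: measurableC.
  by rewrite -[X in measurable X]setCK; exact: measurableC.
have UB : (mu (U `&` B) <= e%:E)%E.
  rewrite -(@leeD2lE _ (mu (~` B)))//.
  rewrite -measureU//; [|exact: measurableC|exact: measurableI|]; last first.
    by apply/seteqP; split => // x [nBx [_ Bx]].
  rewrite -(mu_open _ oU) -(muE (~` B)) in Ue.
  by apply: le_trans Ue; apply: mu_le => x [/BU//|[]].
apply: (@le_trans _ _ (mu ((~` U `&` K) `|` (U `&` B `|` ~` K)))).
  apply: mu_le => x Bx; have [Kx|nKx] := pselect (K x); last by right; right.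
  by have [Ux|nUx] := pselect (U x); [right; left | left].
apply: le_trans (measureU2 _ _ _) _ => //.
  by apply: measurableU => //; exact: measurableI.
apply: leeD.
  apply: ereal_sup_ubound; exists (~` U `&` K) => //; split.
    by rewrite setIC; apply: compact_closedI => //; rewrite closedC.
  by move=> x [nUx _]; apply: contrapT => /BU.
apply: le_trans (measureU2 _ _ _) _ => //; first exact: measurableI.
by rewrite [X in (_ + X)%E]muK adde0.
Qed.

End RieszMeasure.

(** * Extension of positive functionals to bounded functions *)
Section PositiveExtension.
Variables (R : realType) (T : Type) (K : set T) (W : lmodType R).
Variables (ev : W -> T -> R) (one : W) (L : {scalar W}).
Hypothesis evD : forall u v x, ev (u + v) x = ev u x + ev v x.
Hypothesis evZ : forall c u x, ev (c *: u) x = c * ev u x.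
Hypothesis ev1 : forall x, ev one x = 1.
Hypothesis ev_bounded : forall u, exists N, forall x, K x -> `|ev u x| <= N.
Hypothesis L_ge0 : forall u, (forall x, K x -> 0 <= ev u x) -> 0 <= L u.

Definition bounded_on (h : T -> R) : Prop :=
  exists N, forall x, K x -> `|h x| <= N.

(** The functions bounded below by some [ev u] with [L u >= 0] form a cone with
order unit 1.  A maximal proper cone containing it assigns to every bounded
function a constant, and [Lam] is this constant times [L one]. *)
Lemma positive_extension : exists Lam : (T -> R) -> R,
  [/\ forall h k, bounded_on h -> bounded_on k ->
        Lam (fun x => h x + k x) = Lam h + Lam k,
      forall c h, bounded_on h -> Lam (fun x => c * h x) = c * Lam h,
      forall h, bounded_on h -> (forall x, K x -> 0 <= h x) -> 0 <= Lam h &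
      forall u, Lam (ev u) = L u].
Proof.
have evN u x : ev (- u) x = - ev u x by rewrite -scaleN1r evZ mulN1r.
(* If L one = 0, positivity forces L = 0, and that cone is not proper. *)
have [L1|L1] := eqVneq (L one) 0.
  have L_le0 u : L u <= 0.
    have [N evN'] := ev_bounded u.
    have : 0 <= L (N *: one - u).
      apply: L_ge0 => x Kx; rewrite evD evZ ev1 mulr1 evN subr_ge0.
      exact: le_trans (ler_norm _) (evN' x Kx).
    by rewrite linearB linearZ /= L1 mulr0 sub0r oppr_ge0.
  exists (fun=> 0); split => [h k _ _|c h _|h _ _|u]; rewrite ?addr0 ?mulr0//.
  by apply/eqP; rewrite eq_le L_le0 andbT -oppr_le0 -linearN L_le0.
have L1_gt0 : 0 < L one.
  by rewrite lt_def L1; apply: L_ge0 => x _; rewrite ev1.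
pose e : T -> R^o := fun=> 1.
pose M : set (T -> R^o) :=
  [set h | exists2 u, 0 <= L u & forall x, K x -> ev u x <= h x].
have M_ge0 h : (forall x, K x -> 0 <= h x) -> M h.
  move=> h0; exists 0; first by rewrite linear0.
  by move=> x Kx; rewrite -(scale0r one) evZ mul0r h0.
have M_ev u : 0 <= L u -> M (ev u) by move=> u0; exists u.
have sM : stable_cone set0 M.
  split=> //.
  - move=> h k [u u0 uh] [v v0 vk]; exists (u + v).
      by rewrite linearD addr_ge0.
    by move=> x Kx; rewrite evD; apply: lerD; [exact: uh | exact: vk].
  - move=> c h c0 [u u0 uh]; exists (c *: u).
      by rewrite linearZ mulr_ge0.
    by move=> x Kx; rewrite evZ; apply: ler_wpM2l => //; exact: uh.
have Me : M e by apply: M_ge0 => x _; exact: ler01.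
have NMe : ~ M (- e).
  move=> [u u0 ue]; have : 0 <= L (- one - u).
    apply: L_ge0 => x Kx; rewrite evD !evN ev1 subr_ge0.
    exact: ue.
  rewrite linearB linearN /= subr_ge0 => /(le_trans u0).
  by rewrite oppr_ge0 leNgt L1_gt0.
have Phi_lin (phi : (T -> R^o) -> T -> R^o) : set0 phi -> linear phi by [].
have [|S [MS sS NSe Sr]] := maximal_cone Phi_lin _ sM Me NMe; first by [].
have [SD SZ _] := sS.
have Sbnd h : bounded_on h -> exists r, S (h - r *: e) /\ S (r *: e - h).
  move=> [N hN]; apply: Sr; exists N; apply: M_ge0 => x Kx.
    change (0 <= N * 1 - h x); rewrite mulr1 subr_ge0.
    exact: le_trans (ler_norm _) (hN _ Kx).
  change (0 <= N * 1 + h x); rewrite mulr1 -[h x]opprK subr_ge0.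
  by apply: le_trans (ler_norm _) _; rewrite normrN; exact: hN.
have Scst c : S (c *: e) -> 0 <= c.
  move=> Sc; rewrite leNgt; apply/negP => c0; apply: NSe.
  have -> : - e = (- c^-1) *: (c *: e).
    by rewrite scalerA mulNr mulVf ?lt_eqF// scaleN1r.
  by apply: SZ => //; rewrite oppr_ge0 invr_le0 ltW.
pose rho (h : T -> R^o) : R := get [set r | S (h - r *: e) /\ S (r *: e - h)].
have rhoP h : bounded_on h -> S (h - rho h *: e) /\ S (rho h *: e - h).
  by move=> /Sbnd; exact: getPex.
have le_rho h r1 r2 : S (h - r1 *: e) -> S (r2 *: e - h) -> r1 <= r2.
  move=> S1 S2; rewrite -subr_ge0; apply: Scst.
  have -> : (r2 - r1) *: e = (r2 *: e - h) + (h - r1 *: e).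
    by rewrite addrA subrK scalerBl.
  exact: SD.
have rhoU h r : bounded_on h -> S (h - r *: e) -> S (r *: e - h) -> rho h = r.
  move=> /rhoP[S1 S2] S3 S4; apply/eqP; rewrite eq_le.
  by rewrite (le_rho _ _ _ S1 S4) (le_rho _ _ _ S3 S2).
exists (fun h => L one * rho h); split.
- move=> h k hb kb; rewrite -mulrDr; congr (_ * _).
  have [[S1 S2] [S3 S4]] := (rhoP _ hb, rhoP _ kb).
  apply: rhoU.
  + have [[N hN] [N' kN']] := (hb, kb); exists (N + N') => x Kx.
    by rewrite (le_trans (ler_normD _ _))// lerD ?hN ?kN'.
  + rewrite -[fun x => _]/(h + k : T -> R^o) scalerDl opprD addrACA.
    exact: SD.
  + rewrite -[fun x => _]/(h + k : T -> R^o) scalerDl opprD addrACA.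
    exact: SD.
- move=> c h hb; rewrite mulrCA; congr (_ * _).
  have cb : bounded_on (fun x => c * h x).
    have [N hN] := hb; exists (`|c| * N) => x Kx.
    by rewrite normrM ler_wpM2l// hN.
  have [S1 S2] := rhoP _ hb.
  have [c0|/ltW c0] := leP 0 c; apply: rhoU => //;
    rewrite -[fun x => _]/(c *: h : T -> R^o) -scalerA -scalerBr.
  + exact: SZ.
  + exact: SZ.
  + by rewrite -[_ - _]opprB scalerN -scaleNr; apply: SZ; rewrite ?oppr_ge0.
  + by rewrite -[_ - _]opprB scalerN -scaleNr; apply: SZ; rewrite ?oppr_ge0.
- move=> h hb h0; rewrite mulr_ge0 ?(ltW L1_gt0)//.
  have [_ S2] := rhoP _ hb; apply: le_rho S2.
  by rewrite scale0r subr0; apply/MS/M_ge0.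
- move=> u; rewrite -[RHS](mulVKf L1) [_^-1 * _]mulrC; congr (_ * _).
  pose r := L u / L one.
  have evr v : L v = 0 -> S (ev v) by move=> Lv; apply/MS/M_ev; rewrite Lv.
  have Lr : L (u - r *: one) = 0.
    by rewrite linearB linearZ /= /r divfK// subrr.
  have evB v w : ev (v - w) = (ev v : T -> R^o) - ev w.
    by apply/funext => x; rewrite evD evN.
  have evZe c : ev (c *: one) = c *: e.
    by apply/funext => x; rewrite evZ ev1.
  apply: rhoU; first exact: ev_bounded.
    by rewrite -evZe -evB; exact: evr.
  by rewrite -evZe -evB; apply: evr; rewrite -opprB linearN Lr oppr0.
Qed.

End PositiveExtension.

(** * Integral representation *)

(** The two staircase lemmas are the layer-cake approximation: for
0 <= t <= (N + 1) e, with i < N in both sums,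
sum_i e 1_{(i+1) e < t} <= t <= e + sum_i e 1_{(i+1) e < t}. *)
Lemma staircase_le (R : realFieldType) (e t : R) N : 0 <= e -> 0 <= t ->
  \sum_(i < N) e * (i.+1%:R * e < t)%R%:R <= t.
Proof.
move=> e0 t0; elim: N => [|N IH]; first by rewrite big_ord0.
rewrite big_ord_recr /=; case: ltP => [Nt|_]; last by rewrite mulr0 addr0.
apply: le_trans (ltW Nt); rewrite mulr1 -natr1 mulrDl mul1r lerD2r.
apply: le_trans (_ : \sum_(i < N) e <= _).
  by apply: ler_sum => i _; rewrite ler_piMr// lern1 leq_b1.
by rewrite sumr_const card_ord mulr_natl.
Qed.

Lemma le_staircase (R : realFieldType) (e t : R) N : 0 <= e ->
  t <= N.+1%:R * e -> t <= e + \sum_(i < N) e * (i.+1%:R * e < t)%R%:R.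
Proof.
move=> e0; elim: N => [|N IH] tN; first by rewrite big_ord0 addr0 -[e]mul1r.
have [Nt|tN1] := ltP (N.+1%:R * e) t; last first.
  by rewrite big_ord_recr /= addrA (le_trans (IH tN1))// lerDl mulr_ge0.
apply: le_trans tN _; rewrite -natr1 mulrDl mul1r addrC lerD2l.
rewrite (eq_bigr (fun=> e)) ?sumr_const ?card_ord ?mulr_natl// => i _.
rewrite (le_lt_trans _ Nt) ?mulr1// ler_wpM2r// ler_nat; exact: ltn_ord.
Qed.

Section MomentRepresentation.
Variables (R : realType) (d : nat).
Local Notation mp := (mpoly.mpoly d R).
Local Notation borel := (borelRV R d).

Lemma mp_eval_open (p : mp) c : open [set x | c < mp_eval p x].
Proof.
have -> : [set x | c < mp_eval p x] = mp_eval p @^-1` [set y | c < y] by [].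
by apply: open_comp; [move=> x _; exact: mp_eval_continuous | exact: open_gt].
Qed.

Lemma semialg_set_closed s (h : 'I_s -> mp) : closed (semialg_set h).
Proof.
have -> : semialg_set h = \bigcap_i [set x | 0 <= mp_eval (h i) x].
  by apply/seteqP; split => [x hx i _|x hx i]; apply: hx.
rewrite -openC setC_bigcap; apply: bigcup_open => i _.
rewrite (_ : ~` _ = [set x | 0 < mp_eval (- h i) x]); first exact: mp_eval_open.
apply/seteqP; split => x /=; rewrite -[- h i]scaleN1r mp_evalZ mulN1r oppr_gt0.
  by move=> /negP; rewrite -ltNge.
by rewrite ltNge => /negP.
Qed.

Lemma mp_eval_measurable (p : mp) (D : set borel) : measurable D ->
  measurable_fun D (mp_eval p : borel -> R).
Proof.
move=> mD; apply: (measurable_funS measurableT) => // _.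
apply: (measurability _ (RGenOInfty.measurableE R)) => // _ [_ [a ->] <-].
rewrite setTI preimage_itvoy; apply: sub_sigma_algebra; exact: mp_eval_open.
Qed.

(** The measure built from the content satisfies mu(U) <= lam(U) for open U; since
the level sets {p > c} are open, this bounds the integral of a nonnegative
polynomial p by L(p).  Equality of the total masses turns this into the
inequality for every polynomial, and p versus - p into equality. *)
Theorem nonneg_moment_functional (K : set 'rV[R]_d) (L : {scalar mp}) :
  compact K -> closed K ->
  (forall p, (forall x, K x -> 0 <= mp_eval p x) -> 0 <= L p) ->
  moment_functional K L.
Proof.
move=> cK clK L_ge0.
have [Lam [LamD LamZ Lam_ge0 LamE]] := positive_extension
  (@mp_evalD R d) (@mp_evalZ R d) (@mp_eval1 R d)
  (fun p => compact_mp_eval_bounded p cK) L_ge0.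
have Lam_le h k : bounded_on K h -> bounded_on K k ->
    (forall x, K x -> h x <= k x) -> Lam h <= Lam k.
  move=> hb kb hk.
  have hb' : bounded_on K (fun x => -1 * h x).
    by have [N hN] := hb; exists N => x Kx; rewrite mulN1r normrN hN.
  rewrite -subr_ge0 -mulN1r -LamZ// -LamD//; apply: Lam_ge0.
    have [[N hN] [N' kN']] := (hb', kb); exists (N' + N) => x Kx.
    by rewrite (le_trans (ler_normD _ _))// lerD ?hN ?kN'.
  by move=> x Kx; rewrite mulN1r subr_ge0 hk.
have indic_bounded (A : set 'rV[R]_d) : bounded_on K (\1_A : _ -> R).
  by exists 1 => x _; rewrite indicE ger0_norm ?lern1 ?leq_b1.
pose lam (A : set 'rV[R]_d) : R := Lam \1_A.
have lam_ge0 A : 0 <= lam A by apply: Lam_ge0.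
have lamU (A B : set 'rV[R]_d) : A `&` B = set0 -> lam (A `|` B) = lam A + lam B.
  move=> AB; rewrite /lam -LamD//; congr Lam; apply/funext => x.
  by rewrite !indicE in_setU -natrD; congr (_%:R); move/seteqP: AB => [/(_ x) AB _];
    case: (boolP (x \in A)) => //= /set_mem Ax; case: (boolP (x \in B)) => // /set_mem Bx;
    case: AB.
have lamK : lam (~` K) = 0.
  apply/eqP; rewrite eq_le lam_ge0 andbT.
  have <- : Lam (fun x => 0 * \1_K x) = 0 by rewrite LamZ// mul0r.
  apply: Lam_le => //.
    by exists 0 => x _; rewrite mul0r normr0.
  by move=> x Kx; rewrite indicE mul0r memNset// lexx.
have lamT : lam setT = L 1.
  rewrite -LamE /lam; congr Lam; apply/funext => x.
  by rewrite indicE in_setT mp_eval1.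
have [mu [muT muK mu_open mu_fin mu_radon]] :=
  content_radon_measure cK clK lam_ge0 lamU lamK.
have open_measurable (U : set 'rV[R]_d) : open U -> measurable (U : set borel).
  exact: sub_sigma_algebra.
have mK : measurable (K : set borel).
  rewrite -[K]setCK; apply: measurableC; apply: open_measurable.
  by rewrite openC.
have muKE : mu K = (L 1)%:E.
  rewrite -lamT -muT -(setUv K) measureU//; last 2 first.
  - exact: measurableC.
  - exact: setICr.
  by rewrite [X in (_ + X)%E]muK adde0.
have p_int p : mu.-integrable (K : set borel) (fun x => (mp_eval p x)%:E).
  apply: measurable_bounded_integrable => //; first exact: mp_eval_measurable.
  have [N pN] := compact_mp_eval_bounded p cK.
  exists N; split; first exact: num_real.
  by move=> M /ltW NM x Kx; exact: le_trans (pN x Kx) NM.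
pose J p := Rintegral mu (K : set borel) (mp_eval p).
have JE p : (\int[mu]_(x in (K : set borel)) (mp_eval p x)%:E)%E = (J p)%:E.
  by rewrite /J /Rintegral fineK// integrable_fin_num.
have JD p q : J (p + q) = J p + J q.
  rewrite /J -(RintegralD mK (p_int p) (p_int q)).
  by congr Rintegral; apply/funext => x; exact: mp_evalD.
have JZ (c : R) (q : mp) : J (c *: q) = c * J q.
  rewrite /J -(RintegralZl _ mK (p_int q)).
  by congr Rintegral; apply/funext => x; exact: mp_evalZ.
have J1 : J 1 = L 1.
  apply: EFin_inj; rewrite -JE -muKE.
  under eq_integral do rewrite mp_eval1.
  by rewrite integral_cst// mul1e.
have J_le_nonneg p : (forall x, K x -> 0 <= mp_eval p x) -> J p <= L p.
  move=> p0; apply/ler_addgt0Pr => e' e'0.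
  have L1_ge0 : 0 <= L 1 by apply: L_ge0 => x _; rewrite mp_eval1.
  have L11 : 0 < L 1 + 1 by rewrite ltr_wpDl.
  (* The step e makes the error e * L 1 of the staircase at most e'. *)
  pose e := e' / (L 1 + 1); have e0 : 0 < e by rewrite divr_gt0.
  have [C pC] := compact_mp_eval_bounded p cK.
  have [N CN] : exists N, forall x, K x -> mp_eval p x <= N.+1%:R * e.
    exists (Num.trunc (C / e)) => x Kx.
    rewrite -ler_pdivrMr//.
    apply: le_trans (_ : C / e <= _).
      by rewrite ler_pM2r ?invr_gt0// (le_trans (ler_norm _))// pC.
    by rewrite ltW// truncnS_gt.
  pose A i := [set x | i.+1%:R * e < mp_eval p x].
  have mA i : measurable (A i : set borel).
    by apply: open_measurable; exact: mp_eval_open.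
  have step_bounded n : bounded_on K (fun x => \sum_(i < n) e * \1_(A i) x).
    exists (\sum_(i < n) e) => x _; apply: le_trans (ler_norm_sum _ _ _) _.
    apply: ler_sum => i _; rewrite normrM (gtr0_norm e0) ler_piMr ?(ltW e0)//.
    by rewrite indicE ger0_norm ?lern1 ?leq_b1.
  have LamS n : Lam (fun x => \sum_(i < n) e * \1_(A i) x) =
      \sum_(i < n) e * lam (A i).
    elim: n => [|n IH].
      rewrite big_ord0 -[RHS](mul0r (Lam \1_K)) -LamZ//; congr Lam.
      by apply/funext => x; rewrite big_ord0 mul0r.
    rewrite big_ord_recr /= -IH /lam -LamZ// -LamD//.
      by congr Lam; apply/funext => x; rewrite big_ord_recr.
    exists e => x _; rewrite normrM (gtr0_norm e0) ler_piMr ?(ltW e0)//.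
    by rewrite indicE ger0_norm ?lern1 ?leq_b1.
  have A_sum : \sum_(i < N) e * lam (A i) <= L p.
    rewrite -LamS -LamE; apply: Lam_le => //; first by exists C.
    move=> x Kx; apply: le_trans (staircase_le N (ltW e0) (p0 x Kx)).
    by apply: ler_sum => i _; rewrite indicE mem_setE.
  have step_ge0 i x : (0 <= e%:E * (\1_(A i) x)%:E)%E.
    by rewrite -EFinM lee_fin mulr_ge0// ltW.
  have step_meas i : measurable_fun (K : set borel)
      (fun x => e%:E * (\1_(A i) x)%:E)%E.
    by apply: emeasurable_funM => //; apply/measurable_EFinP.
  have sum_ge0 x : (0 <= \sum_(i < N) (e%:E * (\1_(A i) x)%:E))%E.
    by apply: sume_ge0.
  have sum_meas : measurable_fun (K : set borel)
      (fun x => \sum_(i < N) (e%:E * (\1_(A i) x)%:E))%E.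
    exact: emeasurable_sum.
  suff : ((J p)%:E <= (e * L 1)%:E + \sum_(i < N) (e * lam (A i))%:E)%E.
    rewrite sumEFin -EFinD lee_fin => /le_trans; apply.
    rewrite addrC lerD// /e mulrAC ler_pdivrMr// ler_wpM2l ?lerDl//.
    exact: ltW.
  rewrite -JE.
  apply: (@le_trans _ _ (\int[mu]_(x in (K : set borel))
    (e%:E + \sum_(i < N) (e%:E * (\1_(A i) x)%:E)))%E).
    apply: ge0_le_integral => //=.
    - by apply/measurable_EFinP; exact: mp_eval_measurable.
    - exact: emeasurable_funD.
    move=> x Kx; under eq_bigr do rewrite -EFinM.
    rewrite sumEFin -EFinD lee_fin.
    apply: le_trans (le_staircase (ltW e0) (CN x Kx)) _.
    by rewrite lerD2l; apply: ler_sum => i _; rewrite indicE mem_setE.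
  rewrite ge0_integralD//=; last by move=> x _; rewrite lee_fin ltW.
  rewrite integral_cst// muKE -EFinM leeD2l//.
  rewrite ge0_integral_sum//.
  apply: lee_sum => i _.
  rewrite ge0_integralZl_EFin ?(ltW e0)//; last exact/measurable_EFinP.
  rewrite integral_indic// [leRHS]EFinM lee_pmul2l ?lte_fin//.
  have muA : (mu (A i) <= (lam (A i))%:E)%E.
    by apply: mu_open; exact: mp_eval_open.
  apply: le_trans muA.
  by apply: le_measure; rewrite ?inE//; exact: measurableI.
have J_le p : J p <= L p.
  have [N pN] := compact_mp_eval_bounded p cK.
  have := J_le_nonneg (p + N *: 1).
  rewrite JD JZ J1 linearD linearZ /= lerD2r; apply => x Kx.
  rewrite mp_evalD mp_evalZ mp_eval1 mulr1 -[mp_eval p x]opprK addrC subr_ge0.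
  by rewrite (le_trans (ler_norm _))// normrN pN.
exists mu; split => //.
move=> p; split => //; rewrite JE; congr EFin; apply/eqP; rewrite eq_le J_le andbT.
have := J_le (-1 *: p).
by rewrite JZ linearZ /= !mulN1r lerN2.
Qed.

End MomentRepresentation.

(** * The Positivstellensatz and the moment problem *)

Theorem corollary6p2 (R : realType) (d r m : nat)
    (d_gt0 : (0 < d)%N) (r_gt0 : (0 < r)%N)
    (f : 'I_r.+1 -> mpoly.mpoly d R) (f0 : f ord0 = 1)
    (g : 'I_m -> mpoly.mpoly d R) (g_deg1 : forall i, degree_one (g i))
    (Kg_neq0 : semialg_set g !=set0) (Kg_compact : compact (semialg_set g))
    (Kf_sub : semialg_set (fun j : 'I_r => f (lift ord0 j)) `<=`
              semialg_set g) :
  (forall p : mpoly.mpoly d R,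
     (forall x, semialg_set (fun j : 'I_r => f (lift ord0 j)) x ->
        0 < mp_eval p x) ->
     exists s : seq (mpoly.mpoly d R),
       (forall q, q \in s ->
          exists (alpha : R) j n, 0 < alpha /\ q = star_form f g alpha j n) /\
       p = \sum_(q <- s) q) /\
  (forall L : {scalar (mpoly.mpoly d R)},
     (forall j n, 0 <= L (star_form f g 1 j n)) ->
     moment_functional (semialg_set (fun j : 'I_r => f (lift ord0 j))) L).
Proof.
set Kf := semialg_set _ in Kf_sub *.
have archg := compact_polyhedron_archimedean g_deg1 Kg_neq0 Kg_compact.
have pos p : (forall x, Kf x -> 0 < mp_eval p x) -> star_sums f g p.
  exact: star_sums_positivstellensatz.
split=> [p /pos//|L L_star].
have L_sums p : star_sums f g p -> 0 <= L p.
  elim/star_sums_ind => [|u v Lu Lv|alpha j n alpha0].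
  - by rewrite linear0.
  - by rewrite linearD addr_ge0.
  - rewrite /star_form linearZ /= mulr_ge0 ?(ltW alpha0)//.
    by have := L_star j n; rewrite /star_form scale1r.
have clKf : closed Kf by exact: semialg_set_closed.
apply: nonneg_moment_functional => //; first exact: subclosed_compact Kf_sub.
move=> p p_ge0.
have L1_ge0 : 0 <= L 1.
  by apply/L_sums/pos => x _; rewrite mp_eval1.
(* p + eps is positive on Kf, and eps is chosen so that eps * L 1 <= e. *)
apply/ler_addgt0Pr => e e0.
have L11 : 0 < L 1 + 1 by rewrite ltr_wpDl.
have eps0 : 0 < e / (L 1 + 1) by rewrite divr_gt0.
have : 0 <= L (p + (e / (L 1 + 1)) *: 1).
  apply/L_sums/pos => x Kfx; rewrite mp_evalD mp_evalZ mp_eval1 mulr1.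
  by rewrite ltr_wpDl// p_ge0.
rewrite linearD linearZ /= => /le_trans; apply.
rewrite lerD2l mulrAC ler_pdivrMr// ler_wpM2l ?lerDl//.
exact: ltW.
Qed.
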